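(* The modal logic $\mathsf{S4}$ is complete for finite transitive reflexive provability models with necessitation, local soundness and local completeness: if $A\in\mathcal L_\Box$ holds at every world of every such model, then $\mathsf{S4}\vdash A$.
   Context: $\mathsf{S4}$ is $\mathsf K$ (the smallest normal modal logic) plus $\Box A\to\Box\Box A$ and $\Box A\to A$. Language $\mathcal L_\Box$: formulas built from atomic propositions and $\bot$ using $\to$ and a unary $\Box$. A formula is purely modal if it is a Boolean combination of formulas $\Box B$. A theory is a pair of a set of axioms and a set of inference rules (finitely many premises, one conclusion); $\mathsf T\vdash A$ means derivability from axioms by rules. A theory is classical if modus ponens is one of its rules and all classical tautologies are derivable. A provability pre-model is $\mathcal P=(W,\sqsubset,\{L_w\}_{w\in W^\sqsubset},V)$ with $W$ nonempty, $\sqsubset$ a binary relation on $W$, $V\subseteq W\times\mathrm{atoms}$, $W^\sqsubset=\{u:\exists v\,(v\sqsubset u)\}$, and a theory $L_w$ for each $w\in W^\sqsubset$. Satisfaction: atoms via $V$, $\bot$ never holds, $\to$ classical, $\mathcal P,w\Vdash\Box A$ iff $L_u\vdash A$ for all $u$ with $w\sqsubset u$. With $\sqsubset^+$ the transitive closure, $\mathcal P,w\Vdash^+A$ iff there is $u\sqsubset w$ with $\mathcal P,v\Vdash A$ for all $v$ such that $u\sqsubset^+v$. A provability model is a pre-model in which every $L_w$ is classical and which satisfies modal completeness: for every $w\in W^\sqsubset$ and purely modal $A$, $\mathcal P,w\Vdash^+A$ implies $L_w\vdash A$. Necessitation: every $L_w$ has the rule ''from $A$ infer $\Box A$''. Local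 completeness: for every $w\in W^\sqsubset$ and every formula $A$, $\mathcal P,w\Vdash^+A$ implies $L_w\vdash A$. Local soundness: for every $w\in W^\sqsubset$ and every $A$, $L_w\vdash A$ implies $\mathcal P,w\Vdash A$. *)

(* Defs.v *)
From Stdlib Require Import List Relations FinFun.
Import ListNotations.

Inductive form (Atom : Type) : Type :=
| Var (p : Atom)
| Bot
| Imp (A B : form Atom)
| Box (A : form Atom).

Arguments Var {Atom} p.
Arguments Bot {Atom}.
Arguments Imp {Atom} A B.
Arguments Box {Atom} A.

(* [Bot] is the nullary Boolean connective; with [Imp] it generates all the
   others, e.g. the negation [Imp A Bot]. *)
Inductive purely_modal {Atom : Type} : form Atom -> Prop :=
| purely_modal_Box B : purely_modal (Box B)
| purely_modal_Bot : purely_modal Bot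
| purely_modal_Imp A B :
    purely_modal A -> purely_modal B -> purely_modal (Imp A B).

(* A valuation treats atoms and boxed formulas as propositional variables, so
   that the tautologies are the substitution instances in the modal language
   of the tautologies of classical propositional logic. *)
Fixpoint beval {Atom : Type} (v : form Atom -> bool) (A : form Atom) : bool :=
  match A with
  | Var _ | Box _ => v A
  | Bot => false
  | Imp B C => implb (beval v B) (beval v C)
  end.

Definition tautology {Atom : Type} (A : form Atom) : Prop :=
  forall v : form Atom -> bool, beval v A = true.

(* An inference rule is the set of its instances (premises, conclusion). *)
Definition rule (Atom : Type) : Type := list (form Atom) -> form Atom -> Prop.

Definition modus_ponens {Atom : Type} : rule Atom :=
  fun ps C => exists A : form Atom, ps = [Imp A C; A].

Definition nec_rule {Atom : Type} : rule Atom :=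
  fun ps C => exists A : form Atom, ps = [A] /\ C = Box A.

Record theory (Atom : Type) : Type := Theory {
  axioms : form Atom -> Prop;
  rules : rule Atom -> Prop
}.

Arguments Theory {Atom} axioms rules.
Arguments axioms {Atom} t _.
Arguments rules {Atom} t _.

Inductive derivable {Atom : Type} (T : theory Atom) : form Atom -> Prop :=
| derivable_axiom A : axioms T A -> derivable T A
| derivable_rule r ps C :
    rules T r -> r ps C ->
    (forall B, In B ps -> derivable T B) -> derivable T C.

Definition classical {Atom : Type} (T : theory Atom) : Prop :=
  rules T modus_ponens /\
  (forall A : form Atom, tautology A -> derivable T A).

Inductive K_axiom {Atom : Type} : form Atom -> Prop :=
| K_taut A : tautology A -> K_axiom A
| K_dist A B : K_axiom (Imp (Box (Imp A B)) (Imp (Box A) (Box B))).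

Definition K (Atom : Type) : theory Atom :=
  Theory K_axiom (fun r => r = modus_ponens \/ r = nec_rule).

Inductive S4_axiom {Atom : Type} : form Atom -> Prop :=
| S4_K A : axioms (K Atom) A -> S4_axiom A
| S4_4 A : S4_axiom (Imp (Box A) (Box (Box A)))
| S4_T A : S4_axiom (Imp (Box A) A).

Definition S4 (Atom : Type) : theory Atom := Theory S4_axiom (rules (K Atom)).

(* [th] is total; its values outside [in_range] are junk that nothing below
   depends on. *)
Record premodel (Atom : Type) : Type := Premodel {
  world : Type;
  world_nonempty : inhabited world;
  acc : relation world;
  th : world -> theory Atom;
  val : world -> Atom -> Prop
}.

Arguments world {Atom} p.
Arguments world_nonempty {Atom} p.
Arguments acc {Atom} p _ _.
Arguments th {Atom} p _.
Arguments val {Atom} p _ _.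

(* The set of worlds that have a predecessor. *)
Definition in_range {Atom : Type} (P : premodel Atom) (w : world P) : Prop :=
  exists v : world P, acc P v w.

Fixpoint sat {Atom : Type} (P : premodel Atom) (w : world P) (A : form Atom)
    : Prop :=
  match A with
  | Var p => val P w p
  | Bot => False
  | Imp B C => sat P w B -> sat P w C
  | Box B => forall u : world P, acc P w u -> derivable (th P u) B
  end.

Definition sat_plus {Atom : Type} (P : premodel Atom) (w : world P)
    (A : form Atom) : Prop :=
  exists u : world P, acc P u w /\
    forall v : world P, clos_trans (world P) (acc P) u v -> sat P v A.

Definition modally_complete {Atom : Type} (P : premodel Atom) : Prop :=
  forall w : world P, in_range P w ->
  forall A : form Atom, purely_modal A -> sat_plus P w A -> derivable (th P w) A.

Definition provability_model {Atom : Type} (P : premodel Atom) : Prop :=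
  (forall w : world P, in_range P w -> classical (th P w)) /\
  modally_complete P.

Definition necessitation {Atom : Type} (P : premodel Atom) : Prop :=
  forall w : world P, in_range P w -> rules (th P w) nec_rule.

Definition locally_complete {Atom : Type} (P : premodel Atom) : Prop :=
  forall w : world P, in_range P w ->
  forall A : form Atom, sat_plus P w A -> derivable (th P w) A.

Definition locally_sound {Atom : Type} (P : premodel Atom) : Prop :=
  forall w : world P, in_range P w ->
  forall A : form Atom, derivable (th P w) A -> sat P w A.

(* Main.v *)
(* Completeness splits into the finite model property of S4 and a
   transformation of Kripke models into provability models.

   Given a Kripke model, let [L_w] be the set of formulas true at every world
   reachable from [w] in zero or more steps. This set is closed under modus
   ponens and necessitation, so for a transitive model [L_u |- A] for all
   successors [u] of [w] means just that [A] is true at all of them: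
   provability satisfaction coincides with Kripke satisfaction. Local soundness
   and local completeness are then immediate.

   For the finite model property, the worlds are the consistent choices between
   [C] and its negation for every subformula [C] of the given formula, and [w]
   sees [u] when every boxed formula in [w] is in [u]. *)
Require Import Defs.
From Stdlib Require Import List Relations FinFun.
From Stdlib Require Import Classical ClassicalEpsilon ProofIrrelevance.
Import ListNotations.

Fixpoint kripke_sat {Atom W : Type} (R : relation W) (V : W -> Atom -> Prop)
    (w : W) (A : form Atom) : Prop :=
  match A with
  | Var p => V w p
  | Bot => False
  | Imp B C => kripke_sat R V w B -> kripke_sat R V w C
  | Box B => forall u : W, R w u -> kripke_sat R V u B
  end.

Definition Neg {Atom : Type} (A : form Atom) : form Atom := Imp A Bot.

(** * Finite sets of formulas *)

Definition decides {Atom : Type} (g : list (form Atom)) (C : form Atom)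
    : Prop :=
  In C g \/ In (Neg C) g.

Definition is_box {Atom : Type} (A : form Atom) : bool :=
  match A with Box _ => true | _ => false end.

Definition boxes {Atom : Type} (g : list (form Atom)) : list (form Atom) :=
  filter is_box g.

Lemma in_boxes {Atom : Type} (g : list (form Atom)) (A : form Atom) :
  In A (boxes g) <-> exists B, A = Box B /\ In (Box B) g.
Proof.
  unfold boxes. rewrite filter_In. split.
  - intros [HA Hbox]. destruct A as [| | |B]; try discriminate. now exists B.
  - intros [B [-> HB]]. now split.
Qed.

Fixpoint choices {Atom : Type} (l : list (form Atom))
    : list (list (form Atom)) :=
  match l with
  | [] => [[]]
  | C :: l' => flat_map (fun g => [C :: g; Neg C :: g]) (choices l')
  end.

Lemma in_choices_cons {Atom : Type} (C : form Atom) (l g : list (form Atom)) :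
  In g (choices (C :: l)) <->
  exists h, In h (choices l) /\ (g = C :: h \/ g = Neg C :: h).
Proof.
  simpl. rewrite in_flat_map. simpl. firstorder congruence.
Qed.

Lemma choices_decide {Atom : Type} (l g : list (form Atom)) (C : form Atom) :
  In g (choices l) -> In C l -> decides g C.
Proof.
  unfold decides. revert g. induction l as [|D l IH]; intros g Hg HC; [easy|].
  apply in_choices_cons in Hg as [h [Hh Hg]].
  destruct HC as [<- | HC].
  - destruct Hg as [-> | ->]; simpl; tauto.
  - specialize (IH h Hh HC). destruct Hg as [-> | ->]; simpl; tauto.
Qed.

Lemma choices_in_Box {Atom : Type} (l g : list (form Atom)) (B : form Atom) :
  In g (choices l) -> In (Box B) g -> In (Box B) l.
Proof.
  revert g. induction l as [|D l IH]; intros g Hg HB.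
  - destruct Hg as [<- | []]. exact HB.
  - apply in_choices_cons in Hg as [h [Hh [-> | ->]]];
      destruct HB as [HB | HB]; try discriminate; simpl; eauto.
Qed.

Fixpoint subformulas {Atom : Type} (A : form Atom) : list (form Atom) :=
  A :: match A with
       | Imp B C => subformulas B ++ subformulas C
       | Box B => subformulas B
       | _ => []
       end.

Lemma subformulas_refl {Atom : Type} (A : form Atom) : In A (subformulas A).
Proof. destruct A; now left. Qed.

Lemma subformulas_trans {Atom : Type} (A B C : form Atom) :
  In C (subformulas B) -> In B (subformulas A) -> In C (subformulas A).
Proof.
  intros HC. induction A as [p | | A1 IH1 A2 IH2 | A1 IH1]; simpl;
    (intros [<- | HB]; [exact HC | right]); try easy; auto.
  apply in_app_or in HB. apply in_or_app. tauto.
Qed.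

Definition subformula_closed {Atom : Type} (l : list (form Atom)) : Prop :=
  (forall B C, In (Imp B C) l -> In B l /\ In C l) /\
  (forall B, In (Box B) l -> In B l).

Lemma subformulas_closed {Atom : Type} (A : form Atom) :
  subformula_closed (subformulas A).
Proof.
  split.
  - intros B C HBC. split; apply subformulas_trans with (2 := HBC);
      right; apply in_or_app; [left | right]; apply subformulas_refl.
  - intros B HB. apply subformulas_trans with (2 := HB).
    right. apply subformulas_refl.
Qed.

Lemma Finite_sig {X : Type} (P : X -> Prop) (l : list X) :
  (forall x, P x -> In x l) -> Finite {x : X | P x}.
Proof.
  intros Hl.
  exists (flat_map (fun x => match excluded_middle_informative (P x) with
                             | left p => [exist P x p]
                             | right _ => []
                             end) l).
  intros [x p]. apply in_flat_map. exists x. split; [now apply Hl|].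
  destruct (excluded_middle_informative (P x)) as [p' | np]; [|easy].
  left. now apply subset_eq_compat.
Qed.

(** * Derivability from finitely many assumptions *)

(* The head of the list is the innermost premise, which makes the deduction
   theorem [derivable_from_cons] hold by computation. *)
Definition imps {Atom : Type} (g : list (form Atom)) (C : form Atom)
    : form Atom :=
  fold_left (fun D B => Imp B D) g C.

Definition derivable_from {Atom : Type} (T : theory Atom)
    (g : list (form Atom)) (C : form Atom) : Prop :=
  derivable T (imps g C).

Definition consistent {Atom : Type} (T : theory Atom) (g : list (form Atom))
    : Prop :=
  ~ derivable_from T g Bot.

Section ModalTheories.

Context {Atom : Type} {T : theory Atom}.
Implicit Types (B C D : form Atom) (g h l : list (form Atom)).

Hypothesis T_classical : classical T.

Lemma derivable_mp B C :
  derivable T (Imp B C) -> derivable T B -> derivable T C.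
Proof.
  intros HBC HB. apply (derivable_rule T modus_ponens [Imp B C; B]).
  - apply T_classical.
  - now exists B.
  - intros D [<- | [<- | []]]; assumption.
Qed.

Local Ltac by_truth_table :=
  apply T_classical; intros v; simpl;
  repeat match goal with |- context [beval v ?A] => destruct (beval v A) end;
  reflexivity.

Lemma derivable_from_cons g B C :
  derivable_from T (B :: g) C <-> derivable_from T g (Imp B C).
Proof. reflexivity. Qed.

Lemma derivable_from_derivable g C : derivable T C -> derivable_from T g C.
Proof.
  revert C. induction g as [|B g IH]; intros C HC; [exact HC|].
  apply derivable_from_cons, IH, derivable_mp with C; [|exact HC].
  by_truth_table.
Qed.

Lemma derivable_from_mp g B C :
  derivable_from T g (Imp B C) -> derivable_from T g B -> derivable_from T g C.
Proof.
  revert B C. induction g as [|D g IH]; intros B C HBC HB.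
  - now apply derivable_mp with B.
  - apply derivable_from_cons in HBC, HB. apply derivable_from_cons.
    apply IH with (Imp D B); [|exact HB].
    apply IH with (Imp D (Imp B C)); [|exact HBC].
    apply derivable_from_derivable. by_truth_table.
Qed.

Lemma derivable_from_apply g B C :
  derivable T (Imp B C) -> derivable_from T g B -> derivable_from T g C.
Proof. intros HBC. now apply derivable_from_mp, derivable_from_derivable. Qed.

Lemma derivable_from_in g C : In C g -> derivable_from T g C.
Proof.
  induction g as [|B g IH]; [easy|].
  intros [-> | HC]; apply derivable_from_cons.
  - apply derivable_from_derivable. by_truth_table.
  - apply derivable_from_apply with C; [by_truth_table | now apply IH].
Qed.

Lemma derivable_from_cut g h C :
  (forall B, In B h -> derivable_from T g B) ->
  derivable_from T h C -> derivable_from T g C.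
Proof.
  revert C. induction h as [|B h IH]; intros C Hh HC.
  - now apply derivable_from_derivable.
  - apply derivable_from_mp with B; [|apply Hh; now left].
    apply IH; [|exact HC]. intros D HD. apply Hh. now right.
Qed.

Lemma derivable_from_incl g h C :
  incl g h -> derivable_from T g C -> derivable_from T h C.
Proof.
  intros Hgh. apply derivable_from_cut. intros B HB.
  now apply derivable_from_in, Hgh.
Qed.

Lemma derivable_from_by_contradiction g C :
  derivable_from T (Neg C :: g) Bot -> derivable_from T g C.
Proof.
  rewrite derivable_from_cons. apply derivable_from_apply. by_truth_table.
Qed.

Lemma consistent_incl g h : incl g h -> consistent T h -> consistent T g.
Proof. intros Hgh Hh Hg. now apply Hh, derivable_from_incl with g. Qed.

Lemma consistent_derivable_not_in_Neg g C :
  consistent T g -> derivable_from T g C -> ~ In (Neg C) g.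
Proof.
  intros Hg HC HN. apply Hg, derivable_from_mp with C; [|exact HC].
  now apply derivable_from_in.
Qed.

Lemma consistent_cons_or_Neg_cons g C :
  consistent T g -> consistent T (C :: g) \/ consistent T (Neg C :: g).
Proof.
  intros Hg. apply NNPP. intros H.
  apply not_or_and in H as [HC HN]. apply NNPP in HC, HN.
  apply Hg, derivable_from_mp with (Neg C); assumption.
Qed.

Lemma consistent_decides_derivable_in g h C :
  consistent T g -> incl h g -> decides h C -> derivable_from T g C -> In C h.
Proof.
  intros Hg Hhg [HC | HN] HgC; [exact HC|].
  now destruct (consistent_derivable_not_in_Neg g C Hg HgC (Hhg _ HN)).
Qed.

Lemma lindenbaum_choices l g :
  consistent T g -> exists h, In h (choices l) /\ consistent T (g ++ h).
Proof.
  revert g. induction l as [|C l IH]; intros g Hg.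
  - exists []. rewrite app_nil_r. split; [now left | exact Hg].
  - assert (exists D, (D = C \/ D = Neg C) /\ consistent T (D :: g))
      as [D [HD HDg]].
    { destruct (consistent_cons_or_Neg_cons g C Hg); eauto. }
    destruct (IH _ HDg) as [h [Hh Hcons]]. exists (D :: h). split.
    + apply in_choices_cons. exists h. destruct HD as [-> | ->]; tauto.
    + apply consistent_incl with (2 := Hcons). intros B HB.
      simpl. rewrite in_app_iff in *. simpl in HB. tauto.
Qed.

Hypothesis T_nec : rules T nec_rule.
Hypothesis T_K : forall B C,
  derivable T (Imp (Box (Imp B C)) (Imp (Box B) (Box C))).

Lemma derivable_nec B : derivable T B -> derivable T (Box B).
Proof.
  intros HB. apply (derivable_rule T nec_rule [B]).
  - exact T_nec.
  - now exists B.
  - intros D [<- | []]; exact HB.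
Qed.

Lemma derivable_from_map_Box g C :
  derivable_from T g C -> derivable_from T (map Box g) (Box C).
Proof.
  revert C. induction g as [|B g IH]; intros C HC.
  - now apply derivable_nec.
  - apply derivable_from_cons, derivable_from_apply with (Box (Imp B C)).
    + apply T_K.
    + now apply IH.
Qed.

Hypothesis T_4 : forall B, derivable T (Imp (Box B) (Box (Box B))).

Lemma derivable_from_boxes_Box g C :
  derivable_from T (boxes g) C -> derivable_from T g (Box C).
Proof.
  intros HC. apply derivable_from_cut with (map Box (boxes g)).
  - intros B HB. apply in_map_iff in HB as [D [<- HD]].
    apply in_boxes in HD as [E [-> HE]].
    apply derivable_from_apply with (Box E); [apply T_4|].
    now apply derivable_from_in.
  - now apply derivable_from_map_Box.
Qed.

Hypothesis T_T : forall B, derivable T (Imp (Box B) B).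

(** * Finite canonical models *)

Section CanonicalModel.

Variable l : list (form Atom).

Definition canonical_world : Type :=
  {g : list (form Atom) | In g (choices l) /\ consistent T g}.

Definition formulas_at (w : canonical_world) : list (form Atom) := proj1_sig w.

Local Coercion formulas_at : canonical_world >-> list.

Definition canonical_acc : relation canonical_world :=
  fun w u => forall B, In (Box B) w -> In (Box B) u.

Definition canonical_val (w : canonical_world) (p : Atom) : Prop :=
  In (Var p) w.

Lemma canonical_world_finite : Finite canonical_world.
Proof. apply Finite_sig with (choices l). tauto. Qed.

Lemma canonical_acc_refl : reflexive canonical_world canonical_acc.
Proof. intros w B HB. exact HB. Qed.

Lemma canonical_acc_trans : transitive canonical_world canonical_acc.
Proof. intros w u v Hwu Huv B HB. now apply Huv, Hwu. Qed.

Lemma canonical_world_consistent (w : canonical_world) : consistent T w.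
Proof. apply (proj2_sig w). Qed.

Lemma canonical_world_decides (w : canonical_world) C :
  In C l -> decides w C.
Proof. apply choices_decide, (proj2_sig w). Qed.

Lemma canonical_world_in_Box (w : canonical_world) B :
  In (Box B) w -> In (Box B) l.
Proof. apply choices_in_Box, (proj2_sig w). Qed.

Lemma canonical_world_derivable_in (w : canonical_world) C :
  In C l -> derivable_from T w C -> In C w.
Proof.
  intros HC. apply consistent_decides_derivable_in with (h := w).
  - apply canonical_world_consistent.
  - apply incl_refl.
  - now apply canonical_world_decides.
Qed.

Lemma lindenbaum_canonical_world g :
  consistent T g -> exists w : canonical_world, consistent T (g ++ w).
Proof.
  intros Hg. destruct (lindenbaum_choices l g Hg) as [h [Hh Hgh]].
  assert (Hcons : consistent T h).
  { apply consistent_incl with (2 := Hgh). apply incl_appr, incl_refl. }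
  now exists (exist _ h (conj Hh Hcons)).
Qed.

Lemma canonical_world_not_derivable C :
  ~ derivable T C -> exists w : canonical_world, ~ In C w.
Proof.
  intros HC. destruct (lindenbaum_canonical_world [Neg C]) as [w Hw].
  - intros HN. now apply HC, (derivable_from_by_contradiction []).
  - exists w. intros HCw.
    apply (consistent_derivable_not_in_Neg _ C Hw); [|now left].
    apply derivable_from_in. now right.
Qed.

Lemma canonical_acc_witness (w : canonical_world) B :
  ~ derivable_from T w (Box B) ->
  exists u : canonical_world, canonical_acc w u /\ ~ In B u.
Proof.
  intros HB.
  destruct (lindenbaum_canonical_world (Neg B :: boxes w)) as [u Hu].
  { intros H. now apply HB, derivable_from_boxes_Box,
      derivable_from_by_contradiction. }
  exists u. split.
  - intros C HC. apply consistent_decides_derivable_in with (1 := Hu).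
    + now apply incl_tl, incl_appr.
    + now apply canonical_world_decides, canonical_world_in_Box with w.
    + apply derivable_from_in. right. apply in_or_app. left.
      apply in_boxes. now exists C.
  - intros HBu. apply (consistent_derivable_not_in_Neg _ B Hu); [|now left].
    apply derivable_from_in. right. apply in_or_app. now right.
Qed.

Hypothesis l_closed : subformula_closed l.

Lemma canonical_world_in_Imp (w : canonical_world) B C :
  In (Imp B C) l -> In (Imp B C) w <-> (In B w -> In C w).
Proof.
  intros HBC. destruct (proj1 l_closed B C HBC) as [HB HC]. split.
  - intros HBCw HBw. apply canonical_world_derivable_in; [exact HC|].
    now apply derivable_from_mp with B; apply derivable_from_in.
  - intros H. apply canonical_world_derivable_in; [exact HBC|].
    destruct (canonical_world_decides w B HB) as [HBw | HNw].
    + apply derivable_from_apply with C; [by_truth_table|].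
      now apply derivable_from_in, H.
    + apply derivable_from_apply with (Neg B); [by_truth_table|].
      now apply derivable_from_in.
Qed.

Lemma canonical_world_in_Box_iff (w : canonical_world) B :
  In (Box B) l ->
  In (Box B) w <-> forall u : canonical_world, canonical_acc w u -> In B u.
Proof.
  intros HB. split.
  - intros HBw u Hwu.
    apply canonical_world_derivable_in; [now apply l_closed|].
    apply derivable_from_apply with (Box B); [apply T_T|].
    now apply derivable_from_in, Hwu.
  - intros H. apply canonical_world_derivable_in; [exact HB|].
    apply NNPP. intros HN.
    destruct (canonical_acc_witness w B HN) as [u [Hwu HBu]].
    now apply HBu, H.
Qed.

Lemma canonical_truth_lemma C : In C l ->
  forall w : canonical_world,
    kripke_sat canonical_acc canonical_val w C <-> In C w.
Proof.
  induction C as [p | | B IHB C IHC | B IHB]; intros Hl w; simpl.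
  - reflexivity.
  - split; [easy|]. intros HBot.
    now apply (canonical_world_consistent w), derivable_from_in.
  - destruct (proj1 l_closed B C Hl) as [HB HC].
    rewrite (IHB HB w), (IHC HC w). now rewrite canonical_world_in_Imp.
  - pose proof (proj2 l_closed B Hl) as HB.
    rewrite canonical_world_in_Box_iff by exact Hl.
    split; intros H u Hwu; apply IHB, H; assumption.
Qed.

End CanonicalModel.

Theorem finite_kripke_complete (A : form Atom) :
  (forall (W : Type) (R : relation W) (V : W -> Atom -> Prop),
     Finite W -> transitive W R -> reflexive W R ->
     forall w : W, kripke_sat R V w A) ->
  derivable T A.
Proof.
  intros HA. apply NNPP. intros HN.
  destruct (canonical_world_not_derivable (subformulas A) A HN) as [w Hw].
  apply Hw, canonical_truth_lemma.
  - apply subformulas_closed.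
  - apply subformulas_refl.
  - apply HA.
    + apply canonical_world_finite.
    + apply canonical_acc_trans.
    + apply canonical_acc_refl.
Qed.

End ModalTheories.

Lemma S4_classical (Atom : Type) : classical (S4 Atom).
Proof.
  split; [now left|]. intros A HA. now apply derivable_axiom, S4_K, K_taut.
Qed.

Theorem S4_finite_kripke_complete (Atom : Type) (A : form Atom) :
  (forall (W : Type) (R : relation W) (V : W -> Atom -> Prop),
     Finite W -> transitive W R -> reflexive W R ->
     forall w : W, kripke_sat R V w A) ->
  derivable (S4 Atom) A.
Proof.
  apply finite_kripke_complete.
  - apply S4_classical.
  - now right.
  - intros B C. apply derivable_axiom, S4_K, K_dist.
  - intros B. apply derivable_axiom, S4_4.
  - intros B. apply derivable_axiom, S4_T.
Qed.

(** * Provability models from Kripke models *)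

Lemma beval_truth_set {Atom : Type} (P : form Atom -> Prop)
    (v : form Atom -> bool) :
  ~ P Bot -> (forall B C, P (Imp B C) <-> (P B -> P C)) ->
  (forall B, v B = true <-> P B) ->
  forall A, beval v A = true <-> P A.
Proof.
  intros HBot HImp Hv A.
  induction A as [p | | B IHB C IHC | B IHB]; simpl; try apply Hv.
  - now split.
  - rewrite HImp, <- IHB, <- IHC.
    destruct (beval v B), (beval v C); simpl; tauto.
Qed.

Lemma tautology_truth_set {Atom : Type} (P : form Atom -> Prop) :
  ~ P Bot -> (forall B C, P (Imp B C) <-> (P B -> P C)) ->
  forall A, tautology A -> P A.
Proof.
  intros HBot HImp A HA.
  set (v B := if excluded_middle_informative (P B) then true else false).
  apply (beval_truth_set P v HBot HImp); [|apply HA].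
  intros B. unfold v. now destruct (excluded_middle_informative (P B)).
Qed.

Lemma clos_trans_step_rt {X : Type} {R : relation X} (x y z : X) :
  R x y -> clos_refl_trans X R y z -> clos_trans X R x z.
Proof.
  intros Hxy Hyz.
  induction Hyz as [|u z _ Hxu Huz] using clos_refl_trans_ind_left.
  - now apply t_step.
  - apply t_trans with u; [exact Hxu | now apply t_step].
Qed.

Lemma clos_trans_transitive {X : Type} {R : relation X} :
  transitive X R -> inclusion X (clos_trans X R) R.
Proof.
  intros R_trans x z. induction 1 as [x z Hxz | x y z _ Hxy _ Hyz].
  - exact Hxz.
  - now apply R_trans with y.
Qed.

Section ConeModel.

Variables (Atom W : Type) (R : relation W) (V : W -> Atom -> Prop).
Variable W_inhabited : inhabited W.

Definition cone_valid (w : W) (A : form Atom) : Prop :=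
  forall v : W, clos_refl_trans W R w v -> kripke_sat R V v A.

Definition cone_theory (w : W) : theory Atom :=
  Theory (cone_valid w) (rules (K Atom)).

Definition cone_model : premodel Atom :=
  Premodel Atom W W_inhabited R cone_theory V.

Lemma derivable_cone_theory (w : W) (A : form Atom) :
  derivable (cone_theory w) A <-> cone_valid w A.
Proof.
  split; [|exact (derivable_axiom (cone_theory w) A)].
  induction 1 as [A HA | r ps C Hr HC _ IH]; [exact HA|].
  destruct Hr as [-> | ->].
  - destruct HC as [B ->]. intros v Hwv.
    apply (IH (Imp B C)); [now left | exact Hwv |].
    apply (IH B); [right; now left | exact Hwv].
  - destruct HC as [B [-> ->]]. intros v Hwv u Hvu.
    apply (IH B); [now left|].
    apply rt_trans with v; [exact Hwv | now apply rt_step].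
Qed.

Lemma cone_model_classical (w : W) : classical (cone_theory w).
Proof.
  split; [now left|]. intros A HA. apply derivable_cone_theory. intros v _.
  now apply (tautology_truth_set (kripke_sat R V v)).
Qed.

Lemma cone_model_necessitation : necessitation cone_model.
Proof. intros w _. now right. Qed.

Hypothesis R_trans : transitive W R.

Lemma sat_cone_model (A : form Atom) (w : W) :
  sat cone_model w A <-> kripke_sat R V w A.
Proof.
  revert w. induction A as [p | | B IHB C IHC | B IHB]; intros w; simpl.
  - reflexivity.
  - reflexivity.
  - now rewrite IHB, IHC.
  - setoid_rewrite derivable_cone_theory. split.
    + intros H u Hwu. apply (H u Hwu), rt_refl.
    + intros H u Hwu v Huv. apply H.
      apply (clos_trans_transitive R_trans).
      now apply clos_trans_step_rt with u.
Qed.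

Lemma cone_model_locally_sound : locally_sound cone_model.
Proof.
  intros w _ A HA. apply sat_cone_model.
  apply (proj1 (derivable_cone_theory w A) HA), rt_refl.
Qed.

Lemma cone_model_locally_complete : locally_complete cone_model.
Proof.
  intros w _ A [u [Huw HA]]. apply derivable_cone_theory. intros v Hwv.
  apply sat_cone_model, HA. now apply clos_trans_step_rt with w.
Qed.

Lemma cone_model_provability_model : provability_model cone_model.
Proof.
  split.
  - intros w _. apply cone_model_classical.
  - intros w Hw A _. now apply cone_model_locally_complete.
Qed.

End ConeModel.

Theorem theorem3p12 (Atom : Type) (A : form Atom)
    (hA : forall P : premodel Atom,
        provability_model P ->
        Finite (world P) ->
        transitive (world P) (acc P) ->
        reflexive (world P) (acc P) ->
        necessitation P ->
        locally_sound P ->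
        locally_complete P ->
        forall w : world P, sat P w A) :
  derivable (S4 Atom) A.
Proof.
  apply S4_finite_kripke_complete.
  intros W R V W_finite R_trans R_refl w.
  apply (sat_cone_model Atom W R V (inhabits w) R_trans).
  apply hA; [| exact W_finite | exact R_trans | exact R_refl | | |].
  - now apply cone_model_provability_model.
  - apply cone_model_necessitation.
  - now apply cone_model_locally_sound.
  - now apply cone_model_locally_complete.
Qed.
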